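(* Let $X$ be a topological space. Then the Pixley-Roy hyperspace $PR(X)$ satisfies $S^\omega_1(\mathcal{O}_D,\mathcal{O}_D)$ if and only if $X$ satisfies $S^\omega_1(\Omega^2,\Omega^2)$.
   Context: For families $\mathcal{A},\mathcal{B}$ associated with a space, the space satisfies $S^\omega_1(\mathcal{A},\mathcal{B})$ if for every sequence $(A_n)_{n<\omega}$ of elements of $\mathcal{A}$ one can choose $B_n\in A_n$ for each $n<\omega$ such that $\{B_n:n<\omega\}\in\mathcal{B}$. For a space $Z$, $\mathcal{O}_D$ is the collection of all families of open subsets of $Z$ whose union is dense in $Z$. $[X]^{<\omega}$ is the set of all finite subsets of $X$ (including $\emptyset$). $PR(X)=[X]^{<\omega}$ is given the Pixley-Roy topology: a basic open neighbourhood of $F\in PR(X)$ is a set $[F,U]=\{G\in PR(X):F\subset G\subset U\}$, where $U\subset X$ is open in $X$ and $F\subset U$. Let $\tau$ be the topology of $X$. An $\omega$-double cover of $X$ is a family $\mathcal{F}\subset\{(F,U)\in[X]^{<\omega}\times\tau: F\subset U\}$ such that for every pair $(G,V)\in[X]^{<\omega}\times\tau$ with $G\subset V$ there is $(F,U)\in\mathcal{F}$ with $F\subset V$ and $G\subset U$. $\Omega^2$ is the family of all $\omega$-double covers of $X$. *)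

(* Defs.v *)
From HB Require Import structures.
From mathcomp Require Import all_boot finmap.
From mathcomp Require Import boolp classical_sets filter topology.

Set Implicit Arguments.
Unset Strict Implicit.
Unset Printing Implicit Defensive.

Local Open Scope classical_set_scope.

(* The selection principle; the space enters only through the families A, B. *)
Definition S1omega (T : Type) (A B : set (set T)) : Prop :=
  forall A_ : nat -> set T, (forall n, A (A_ n)) ->
    exists b : nat -> T, (forall n, A_ n (b n)) /\ B (range b).

Definition O_D (Z : topologicalType) : set (set (set Z)) :=
  [set A | A `<=` open /\ dense (\bigcup_(U in A) U)].

(* Since topologicalType does not require a point, X may be empty. *)
Definition PR (X : topologicalType) : Type := {fset X}.

HB.instance Definition _ (X : topologicalType) := Choice.on (PR X).

Section PixleyRoy.
Variable X : topologicalType.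

(* The basic set [F, U]. *)
Definition PR_basic (F : PR X) (U : set X) : set (PR X) :=
  [set G | (F `<=` G)%fset /\ [set` G] `<=` U].

Definition PR_nbhs (F : PR X) : set_system (PR X) :=
  filter_from [set U | open U /\ [set` F] `<=` U] (PR_basic F).

HB.instance Definition _ := hasNbhs.Build (PR X) PR_nbhs.

Let PR_nbhs_filter (F : PR X) : ProperFilter (nbhs F).
Proof.
apply: filter_from_proper; last by move=> U [_ FU]; exists F; split.
apply: filter_from_filter; first by exists setT; split => //; exact: openT.
move=> U V [oU FU] [oV FV]; exists (U `&` V).
  by split; [exact: openI | rewrite subsetI].
by move=> G [FG]; rewrite subsetI => -[GU GV].
Qed.

Let PR_nbhs_singleton (F : PR X) (A : set (PR X)) : nbhs F A -> A F.
Proof. by case=> U [_ FU]; apply; split. Qed.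

Let PR_nbhs_nbhs (F : PR X) (A : set (PR X)) : nbhs F A -> nbhs F (nbhs^~ A).
Proof.
case=> U [oU FU] FUA; exists U => // G [FG GU]; exists U => // H [GH HU].
by apply: FUA; split => //; exact: fsubset_trans GH.
Qed.

HB.instance Definition _ := Nbhs_isNbhsTopological.Build (PR X)
  PR_nbhs_filter PR_nbhs_singleton PR_nbhs_nbhs.

Lemma nbhs_PRE (F : PR X) :
  nbhs F = filter_from [set U | open U /\ [set` F] `<=` U] (PR_basic F).
Proof. by []. Qed.

Lemma open_PRE (W : set (PR X)) :
  open W <-> forall F, W F ->
    exists U, [/\ open U, [set` F] `<=` U & PR_basic F U `<=` W].
Proof.
rewrite openE; split => WP F /WP.
  by case=> U [oU FU] UW; exists U.
by case=> U [oU FU UW]; exists U.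
Qed.

Definition Omega2 : set (set ({fset X} * set X)) :=
  [set C | C `<=` [set FU | open FU.2 /\ [set` FU.1] `<=` FU.2] /\
    forall (G : {fset X}) (V : set X), open V -> [set` G] `<=` V ->
      exists FU, [/\ C FU, [set` FU.1] `<=` V & [set` G] `<=` FU.2]].

End PixleyRoy.

Arguments O_D Z : clear implicits.
Arguments Omega2 X : clear implicits.

(* Main.v *)
Require Import Defs.
From mathcomp Require Import all_boot finmap.
From mathcomp Require Import boolp classical_sets filter topology.

Set Implicit Arguments.
Unset Strict Implicit.
Unset Printing Implicit Defensive.

Local Open Scope classical_set_scope.

(** When F is included in U and G in V, the basic sets [F, U] and [G, V] meet
    iff F is included in V and G in U, a common element being the union of F
    and G.  Hence omega-double covers are exactly the families of pairs (F, U)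
    whose basic sets [F, U] have dense union, and a selection is transferred
    from one side to the other by replacing pairs by basic sets, respectively
    dense families of open sets by the basic sets that refine them. *)

Section PixleyRoyTopology.
Variable X : topologicalType.
Implicit Types (F G : {fset X}) (U V : set X).

Lemma open_PR_basic F U : open U -> open (PR_basic F U : set (PR X)).
Proof.
move=> oU; apply/open_PRE => G [FG GU]; exists U; split => // H [GH HU].
by split => //; exact: fsubset_trans GH.
Qed.

Lemma PR_basic_meets F G U V : [set` F] `<=` U -> [set` G] `<=` V ->
  PR_basic F U `&` PR_basic G V !=set0 <-> [set` F] `<=` V /\ [set` G] `<=` U.
Proof.
move=> FU GV; split=> [[H [[/fsubsetP FH HU] [/fsubsetP GH HV]]]|[FV GU]].
  by split=> x /= => [/FH /HV|/GH /HU].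
exists (F `|` G)%fset; split; (split; first by rewrite ?fsubsetUl ?fsubsetUr).
  by move=> x /=; rewrite inE => /orP[/FU|/GU].
by move=> x /=; rewrite inE => /orP[/FV|/GV].
Qed.

Lemma dense_PRE (D : set (PR X)) :
  dense D <-> forall G V, open V -> [set` G] `<=` V ->
    PR_basic G V `&` D !=set0.
Proof.
split=> [dD G V oV GV|dD W [G WG] /open_PRE/(_ G WG)[V [oV GV VW]]].
  by apply: dD; [exists G; split|exact: open_PR_basic].
by have [H [/VW WH DH]] := dD G V oV GV; exists H.
Qed.

(** By [dense_PRE], density is tested on the sets [PR_basic G V]; by [PR_basic_meets], each such
    test is the covering condition at [(G, V)]. *)
Lemma Omega2_dense (C : set ({fset X} * set X)) :
  C `<=` [set FU | open FU.2 /\ [set` FU.1] `<=` FU.2] ->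
  Omega2 X C <->
  dense (\bigcup_(FU in C) PR_basic FU.1 FU.2 : set (PR X)).
Proof.
move=> CP; rewrite dense_PRE; split=> [[_ Ccov] G V oV GV|dC].
  have [FU [CFU FV GU]] := Ccov G V oV GV.
  have [H [FUH GVH]] : PR_basic FU.1 FU.2 `&` PR_basic G V !=set0.
    by apply/PR_basic_meets => //; exact: (CP _ CFU).2.
  by exists H; split => //; exists FU.
split=> // G V oV GV; have [H [GVH [FU CFU FUH]]] := dC G V oV GV.
have FsubU := (CP _ CFU).2.
have [FV GU] : [set` FU.1] `<=` V /\ [set` G] `<=` FU.2.
  by apply/PR_basic_meets => //; exists H.
by exists FU.
Qed.

End PixleyRoyTopology.

Theorem theorem2p6 (X : topologicalType) :
  S1omega (O_D (PR X)) (O_D (PR X)) <-> S1omega (Omega2 X) (Omega2 X).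
Proof.
split=> [SPR C C_cov|SX A A_OD].
- have CP n := (C_cov n).1.
  have [n|W [CW [_ dW]]] :=
      SPR (fun n => [set PR_basic FU.1 FU.2 | FU in C n] : set (set (PR X))).
    split=> [_ [FU CFU <-]|].
      by apply: open_PR_basic; exact: (CP n _ CFU).1.
    by rewrite bigcup_image; apply/Omega2_dense.
  (* A basic set may come from several pairs; any one in [C n] will do, since density sees only the
     basic set. *)
  have /choice[p pP] n : exists FU, C n FU /\ PR_basic FU.1 FU.2 = W n.
    by have [FU ? ?] := CW n; exists FU.
  exists p; split=> [n|]; first exact: (pP n).1.
  apply/Omega2_dense=> [_ [n _ <-]|]; first exact: (CP n _ (pP n).1).
  move: dW; rewrite !bigcup_image; congr dense.
  by apply: eq_bigcupr => n _; case: (pP n).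
(* Since the members of [A n] are open, the basic sets of the pairs in [C n] have the same union as
   [A n], hence a dense one. *)
- pose C n := [set FU : {fset X} * set X | [/\ open FU.2, [set` FU.1] `<=` FU.2
    & exists2 W : set (PR X), A n W & PR_basic FU.1 FU.2 `<=` W]].
  have CP n : C n `<=` [set FU | open FU.2 /\ [set` FU.1] `<=` FU.2].
    by move=> FU [].
  have [n|p [pC pcov]] := SX C.
    apply/Omega2_dense => // O O0 oO.
    have [oA dA] := A_OD n; have [H [OH [W AW WH]]] := dA O O0 oO.
    have [U [oU HU UW]] := (open_PRE W).1 (oA W AW) H WH.
    by exists H; split=> //; exists (H, U); [split=> //; exists W|split].
  (* Enlarging each selected basic set to a member of [A n] containing it keeps the union dense. *)
  have /choice[W WP] n : exists W : set (PR X),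
      A n W /\ PR_basic (p n).1 (p n).2 `<=` W.
    by have [_ _ [W]] := pC n; exists W.
  exists W; split=> [n|]; first exact: (WP n).1.
  split=> [_ [n _ <-]|O O0 oO]; first exact: (A_OD n).1 _ (WP n).1.
  have /Omega2_dense : range p `<=` [set FU | open FU.2 /\ [set` FU.1] `<=` FU.2].
    by move=> _ [n _ <-]; exact: (CP n).
  move=> /iffLR /(_ pcov) /(_ O O0 oO)[H [OH [_ [n _ <-] pH]]].
  by exists H; split=> //; exists (W n); [exists n|exact: (WP n).2].
Qed.
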